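(* Let $G\subset \mathrm{SL}(2,\mathbb C)$ be a finite abelian subgroup of cardinality $k=|G|$. Then the space of generic stability conditions $\Theta^{\mathrm{gen}}$ for $G$-constellations on $\mathbb A^2$ is the disjoint union of $k!$ chambers.
   Context: A $G$-constellation is a coherent $G$-equivariant sheaf $\mathscr F$ on $\mathbb A^2=\mathbb A^2_{\mathbb C}$ (for the linear action of $G$ on $\mathbb A^2$) such that $H^0(\mathbb A^2,\mathscr F)\cong\mathbb C[G]$ (regular representation) as $G$-representations. Let $R(G)$ be the Grothendieck group of representations of $G$. The space of stability conditions is $\Theta=\{\theta\in\mathrm{Hom}_{\mathbb Z}(R(G),\mathbb Q)\mid \theta(\mathbb C[G])=0\}$. For $\theta\in\Theta$, a $G$-constellation $\mathscr F$ is $\theta$-stable (resp. $\theta$-semistable) if $\theta(H^0(\mathbb A^2,\mathscr E))>0$ (resp. $\ge 0$) for every $G$-equivariant subsheaf $0\subsetneq\mathscr E\subsetneq\mathscr F$. A stability condition $\theta$ is generic if every $\theta$-semistable $G$-constellation is $\theta$-stable; $\Theta^{\mathrm{gen}}\subset\Theta$ is the set of generic stability conditions. It is known that $\Theta^{\mathrm{gen}}$ is open and dense in $\Theta$ and is the disjoint union of finitely many open convex polyhedral cones, called chambers: these are the connected components of $\Theta^{\mathrm{gen}}$, in the sense that $\theta,\theta'\in\Theta^{\mathrm{gen}}$ lie in the same chamber if and only if the rational segment joining them is contained in $\Theta^{\mathrm{gen}}$. The set of $\theta$-stable $G$-constellations is constant for $\theta$ in a chamber. *)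

(* Defs.v *)
From HB Require Import structures.
From mathcomp Require Import all_boot all_order all_algebra all_fingroup.
From mathcomp Require Import all_solvable all_field mxrepresentation.
From mathcomp Require Import complex.
From mathcomp Require Import boolp classical_sets cardinality reals.

Set Implicit Arguments.
Unset Strict Implicit.
Unset Printing Implicit Defensive.

Import GroupScope Order.TTheory GRing.Theory Num.Theory.
Local Open Scope classical_set_scope.
Local Open Scope ring_scope.

(* Convention.  As everywhere in mxrepresentation, matrices act on row vectors
   from the right, so all actions are right actions: G acts on A^2 = 'rV_2 by
   p |-> p *m rho g, on functions by (f . g)(p) = f (p *m rho g^-1), and on the
   global sections of an equivariant sheaf by m |-> m *m rF g, subject to
   (f m) . g = (f . g) (m . g).  A subspace is the row space of a matrix.
   The corresponding left action, where g sends p to p *m rho g^-1, is given on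
   columns by (rho g^-1)^T, which for \det (rho g) = 1 is conjugate to
   rho g by a fixed element of SL_2, so this is the standard action of G on A^2
   in other coordinates. *)

Section Constellations.

Variables (R : realType) (gT : finGroupType) (G : {group gT}).
Variable rho : mx_representation R[i] G 2.

(* A^2 is affine, so a G-equivariant coherent sheaf F is the same thing as a
   finitely generated C[x_0, x_1]-module H^0(F) with a compatible action of G.
   Constellations have finite-dimensional H^0, so only such sheaves are
   considered: in a basis of H^0(F) the module structure amounts to the two
   commuting matrices by which the coordinate functions x_0, x_1 act.
   Equivariance is required for f = x_j, and then holds for every f, where
   x_j . g = \sum_i (rho g^-1) i j *: x_i. *)
Record equivariant_sheaf := EquivariantSheaf {
  sheaf_dim : nat;
  sheaf_H0 : mx_representation R[i] G sheaf_dim;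
  sheaf_coord : 'I_2 -> 'M[R[i]]_sheaf_dim;
  sheaf_coordC : forall i j,
    sheaf_coord i *m sheaf_coord j = sheaf_coord j *m sheaf_coord i;
  sheaf_equivariant : forall g j, g \in G ->
    sheaf_coord j *m sheaf_H0 g =
      \sum_i rho g^-1%g i j *: (sheaf_H0 g *m sheaf_coord i) }.

Definition constellation (F : equivariant_sheaf) : Prop :=
  mx_rsim (sheaf_H0 F) (regular_repr R[i] G).

(* The row space of U is closed under multiplication by functions; together
   with mxmodule (sheaf_H0 F) U this makes it a G-equivariant subsheaf. *)
Definition coord_stable (F : equivariant_sheaf) (U : 'M[R[i]]_(sheaf_dim F)) :=
  [forall j, stablemx U (sheaf_coord F j)].

(* A homomorphism R(G) -> Q, given by its values on classes of representations:
   R(G) is generated by the isomorphism classes [V], subject to the relations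
   [V] = [U] + [V / U] for every subrepresentation U of V. *)
Definition rep_function := forall n, mx_representation R[i] G n -> rat.

Definition grothendieck_hom (theta : rep_function) : Prop :=
  (forall n1 n2 (r1 : mx_representation R[i] G n1)
      (r2 : mx_representation R[i] G n2),
      mx_rsim r1 r2 -> theta n1 r1 = theta n2 r2) /\
  (forall n (r : mx_representation R[i] G n) (U : 'M[R[i]]_n)
      (Umod : mxmodule r U),
      theta n r = theta _ (submod_repr Umod) + theta _ (factmod_repr Umod)).

Definition stability_space : set rep_function :=
  [set theta | grothendieck_hom theta /\ theta _ (regular_repr R[i] G) = 0].

Definition stable (theta : rep_function) (F : equivariant_sheaf) : Prop :=
  forall (U : 'M[R[i]]_(sheaf_dim F)) (Umod : mxmodule (sheaf_H0 F) U),
    coord_stable U -> U != 0 -> ~~ row_full U ->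
    0 < theta _ (submod_repr Umod).

Definition semistable (theta : rep_function) (F : equivariant_sheaf) : Prop :=
  forall (U : 'M[R[i]]_(sheaf_dim F)) (Umod : mxmodule (sheaf_H0 F) U),
    coord_stable U -> U != 0 -> ~~ row_full U ->
    0 <= theta _ (submod_repr Umod).

Definition generic_stability : set rep_function :=
  [set theta | stability_space theta /\
    forall F, constellation F -> semistable theta F -> stable theta F].

Definition segment_point (theta theta' : rep_function) (t : rat) :
    rep_function :=
  fun n r => (1 - t) * theta n r + t * theta' n r.

Definition chamber_of (theta : rep_function) : set rep_function :=
  [set theta' | generic_stability theta' /\
    forall t : rat, 0 <= t <= 1 ->
      generic_stability (segment_point theta theta' t)].

Definition chambers : set (set rep_function) :=
  [set chamber_of theta | theta in generic_stability].

End Constellations.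

(* Main.v *)
(* Diagonalizing rho yields a faithful character chi of G with rho = chi + chi^-1, so G
   is cyclic of order k and its irreducible representations are the chi^i, i in Z/k.  A
   constellation is a line in each weight i, on which the two eigencoordinates act by
   arrows i -> i + 1 and i -> i - 1; its subsheaves are the sets of weights closed under
   the nonzero arrows.  A stability condition theta is determined by its values theta_i
   on the chi^i, which sum to 0, hence by a potential P on Z/k with
   theta_i = P (i + 1) - P i, and theta of the cyclic interval [i, j) is P j - P i.
   Then theta is generic iff P is injective.  If it is, a subsheaf of theta-value 0 of a
   semistable constellation splits off a cyclic interval of value 0, which is impossible.
   If P j1 = P j2 = p, orient the arrow between j - 1 and j upwards when P j < p,
   downwards when P j > p, and kill it when P j = p: the resulting constellation is
   semistable and [j1, j2) is a subsheaf of value 0.  Hence the chambers are the orders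
   in which P can list Z/k, that is, the k! permutations. *)

Require Import Defs.
From mathcomp Require Import all_boot all_order all_algebra all_fingroup.
From mathcomp Require Import all_solvable all_field mxrepresentation.
From mathcomp Require Import complex reals ring.
Import GroupScope Order.TTheory GRing.Theory Num.Theory.
Local Open Scope ring_scope.

Set Implicit Arguments.
Unset Strict Implicit.
Unset Printing Implicit Defensive.
(** In a rank factorization [E = A *m B] both factors cancel, so idempotence forces [B *m A = 1],
    and the trace is cyclic. Ranks of projectors thus become computable from characters. *)
Lemma mxtrace_idem (F : fieldType) n (E : 'M[F]_n) :
  E *m E = E -> \tr E = (\rank E)%:R.
Proof.
move=> idE; have cE : col_base E *m row_base E = E by apply: mulmx_base.
rewrite -{1}cE mxtrace_mulC.
suff -> : row_base E *m col_base E = 1%:M by rewrite mxtrace1.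
move: (col_base_full E) (row_base_free E) cE.
move: (col_base E) (row_base E) => A B /row_fullP[L LA] /row_freeP[K BK] AB.
have : L *m (A *m B) *m (A *m B) *m K = L *m (A *m B) *m K.
  by rewrite -(mulmxA L) AB idE.
by rewrite -!mulmxA BK mulmx1 !(mulmxA L) LA !mul1mx.
Qed.

(** * Weight spaces of a faithful character *)

Section FaithfulCharacter.

Variables (F : numFieldType) (gT : finGroupType) (G : {group gT}) (chi : gT -> F).
Hypothesis chiM : {in G &, {morph chi : x y / (x * y)%g >-> x * y}}.
Hypothesis chi_eq1 : {in G, forall x, chi x = 1 <-> x = 1%g}.

Lemma char1 : chi 1%g = 1.
Proof. by apply/chi_eq1. Qed.

Lemma char_neq0 x : x \in G -> chi x != 0.
Proof.
move=> Gx; apply/eqP => c0; have := chiM Gx (groupVr Gx).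
by rewrite mulgV char1 c0 mul0r => /eqP; rewrite oner_eq0.
Qed.

Lemma charV x : x \in G -> chi x^-1%g = (chi x)^-1.
Proof.
move=> Gx; apply: (mulfI (char_neq0 Gx)).
by rewrite -chiM ?groupV // mulgV char1 divff ?char_neq0.
Qed.

Lemma charX n x : x \in G -> chi (x ^+ n)%g = chi x ^+ n.
Proof.
move=> Gx; elim: n => [|n IH]; first by rewrite char1.
by rewrite expgS exprS chiM ?groupX // IH.
Qed.

(** [chi] embeds [G] into the multiplicative group of a field, so [G] is cyclic and a generator goes
    to a root of unity of full order. *)
Lemma char_prim : exists2 x, x \in G & #|G|.-primitive_root (chi x).
Proof.
have /cyclicP[x defG] : cyclic G by apply: (field_mul_group_cyclic chiM chi_eq1).
have Gx : x \in G by rewrite defG cycle_id.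
exists x => //; apply/andP; split; first exact: cardG_gt0.
apply/forallP => -[i lt_i] /=; rewrite unity_rootE -charX //; apply/eqP.
rewrite (_ : chi (x ^+ i.+1)%g == 1 = (x ^+ i.+1 == 1)%g); last first.
  by apply/eqP/eqP; apply chi_eq1; rewrite groupX.
rewrite -order_dvdn orderE -defG eqn_leq lt_i /=.
apply/idP/idP => [/dvdn_leq->//|le_i].
by have /eqP-> : i.+1 == #|G| by rewrite eqn_leq lt_i.
Qed.

Lemma char_expk x : x \in G -> chi x ^+ #|G| = 1.
Proof. by move=> Gx; rewrite -charX // expg_cardG // char1. Qed.

Lemma natrG_neq0 : #|G|%:R != 0 :> F.
Proof. by rewrite pnatr_eq0 -lt0n cardG_gt0. Qed.

(** Translating the sum by an element whose [chi]-value is a primitive root multiplies it by a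
    factor different from 1 when [i != j]. *)
Lemma char_orthogonality (i j : 'I_#|G|) :
  \sum_(x in G) chi x ^+ i * chi x ^- j = if i == j then #|G|%:R else 0.
Proof.
case: eqP => [->|/eqP ne_ij].
  rewrite (eq_bigr (fun=> 1)) ?sumr_const // => x Gx.
  by rewrite divff ?expf_neq0 ?char_neq0.
have [z Gz prim_z] := char_prim.
set S := \sum_(x in G) _.
have eqS : (chi z ^+ i * chi z ^- j) * S = S.
  rewrite [RHS](reindex_inj (mulgI z)) /= mulr_sumr.
  apply: eq_big => [x|x Gx]; first by rewrite groupMl.
  by rewrite chiM // !exprMn invfM mulrACA.
apply: contraNeq ne_ij => nzS; have /(canRL (mulfK nzS)) := eqS.
rewrite divff // => /(canRL (mulfVK (expf_neq0 j (char_neq0 Gz)))).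
rewrite mul1r => /eqP; rewrite (eq_prim_root_expr prim_z) !modn_small //.
Qed.

(** * Projectors onto weight spaces *)

Section WeightProjector.

Variables (n : nat) (r : mx_representation F G n).
Implicit Types i j : 'I_#|G|.

Definition weight_proj i : 'M[F]_n :=
  #|G|%:R^-1 *: \sum_(x in G) chi x ^- i *: r x.

Definition weight_mult i := \rank (weight_proj i).

Lemma weight_projJ i x : x \in G -> weight_proj i *m r x = chi x ^+ i *: weight_proj i.
Proof.
move=> Gx; rewrite /weight_proj -scalemxAl scalerA mulrC -scalerA; congr (_ *: _).
rewrite mulmx_suml scaler_sumr [RHS](reindex_inj (mulIg x)) /=.
apply: eq_big => [y|y Gy]; first by rewrite groupMr.
rewrite repr_mxM // -scalemxAl scalerA chiM // exprMn invfM mulrCA divff ?mulr1 //.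
by rewrite expf_neq0 ?char_neq0.
Qed.

(** Orthogonality of characters. Allowing any number of rows in [v] covers both weight vectors and
    the projectors themselves. *)
Lemma weight_vector_proj m (v : 'M_(m, n)) i j :
    (forall x, x \in G -> v *m r x = chi x ^+ i *: v) ->
  v *m weight_proj j = if i == j then v else 0.
Proof.
move=> vJ; rewrite /weight_proj -scalemxAr mulmx_sumr.
under eq_bigr => x Gx do rewrite -scalemxAr vJ // scalerA mulrC.
rewrite -scaler_suml char_orthogonality scalerA.
by case: eqP; rewrite ?mulr0 ?scale0r // mulVf ?scale1r ?natrG_neq0.
Qed.

Lemma weight_proj_idem i : weight_proj i *m weight_proj i = weight_proj i.
Proof.
by rewrite (weight_vector_proj (i := i)) ?eqxx // => x; apply: weight_projJ.
Qed.

(** Up to the factor [#|G|%:R^-1], the coefficient of [r x] is a geometric sum in [(chi x)^-1],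
    which vanishes for [x != 1] by faithfulness of [chi]. *)
Lemma sum_weight_proj : \sum_i weight_proj i = 1%:M.
Proof.
rewrite /weight_proj -scaler_sumr exchange_big /=.
rewrite (bigD1 1%g) //= [X in _ + X]big1 => [|x /andP[Gx nt_x]].
  rewrite addr0; under eq_bigr do rewrite char1 expr1n invr1 scale1r repr_mx1.
  by rewrite sumr_const card_ord -scaler_nat scalerA mulVf ?scale1r ?natrG_neq0.
rewrite -scaler_suml; under eq_bigr do rewrite -exprVn.
apply/eqP; rewrite scaler_eq0; apply/orP; left; have := subrX1 (chi x)^-1 #|G|.
rewrite exprVn char_expk // invr1 subrr => /esym/eqP; rewrite mulf_eq0 => /orP[|//].
rewrite subr_eq0 invr_eq1 => /eqP /chi_eq1 x1; case/eqP: nt_x; exact: x1.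
Qed.

(** The rank of a projector is its trace, so multiplicities inherit invariance and additivity from
    traces. *)
Lemma weight_mult_tr i :
  (weight_mult i)%:R = #|G|%:R^-1 * \sum_(x in G) chi x ^- i * \tr (r x).
Proof.
rewrite -mxtrace_idem ?weight_proj_idem // mxtraceZ raddf_sum /=.
by congr (_ * _); apply: eq_bigr => x _; rewrite mxtraceZ.
Qed.

Lemma sum_weight_mult : \sum_i weight_mult i = n.
Proof.
apply/eqP; rewrite -(eqr_nat F) natr_sum; apply/eqP.
rewrite -(@mxtrace1 F) -sum_weight_proj raddf_sum; apply: eq_bigr => i _ /=.
by rewrite mxtrace_idem ?weight_proj_idem.
Qed.

End WeightProjector.

Lemma weight_mult_rsim n1 n2 (r1 : mx_representation F G n1)
    (r2 : mx_representation F G n2) i :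
  mx_rsim r1 r2 -> weight_mult r1 i = weight_mult r2 i.
Proof.
move=> sim12; apply/eqP; rewrite -(eqr_nat F) !weight_mult_tr; apply/eqP.
by congr (_ * _); apply: eq_bigr => x Gx; rewrite (mxtrace_rsim sim12).
Qed.

Lemma weight_mult_sub_fact n (r : mx_representation F G n) (U : 'M_n)
    (Umod : mxmodule r U) i :
  (weight_mult r i = weight_mult (submod_repr Umod) i
                     + weight_mult (factmod_repr Umod) i)%N.
Proof.
apply/eqP; rewrite -(eqr_nat F) natrD !weight_mult_tr -mulrDr -big_split /=.
by apply/eqP; congr (_ * _); apply: eq_bigr => x Gx; rewrite -mulrDr mxtrace_sub_fact_mod.
Qed.

Lemma char_mx_repr (i : 'I_#|G|) : mx_repr G (fun x => (chi x ^+ i)%:M : 'M_1).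
Proof.
split=> [|x y Gx Gy]; first by rewrite char1 expr1n.
by rewrite chiM // exprMn scalar_mxM.
Qed.
Definition char_repr i := MxRepresentation (char_mx_repr i).

Lemma weight_mult_char i j : weight_mult (char_repr i) j = (i == j).
Proof.
apply/eqP; rewrite -(eqr_nat F) weight_mult_tr; apply/eqP.
under eq_bigr do rewrite mxtrace_scalar mulr1n mulrC.
by rewrite char_orthogonality; case: eqP; rewrite ?mulr0 // mulVf ?natrG_neq0.
Qed.

Lemma mxtrace_regular x : x \in G ->
  \tr (regular_repr F G x) = if x == 1%g then #|G|%:R else 0.
Proof.
move=> Gx; case: eqP => [->|/eqP nt_x]; first by rewrite repr_mx1 mxtrace1.
rewrite /mxtrace big1 // => i _; rewrite !mxE eqxx /= -(inj_eq enum_val_inj).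
rewrite gring_indexK ?groupM ?enum_valP // -{1}[enum_val i]mulg1.
by rewrite (inj_eq (mulgI _)) eq_sym (negPf nt_x).
Qed.

Lemma weight_mult_regular i : weight_mult (regular_repr F G) i = 1%N.
Proof.
apply/eqP; rewrite -(eqr_nat F) weight_mult_tr; apply/eqP.
rewrite (bigD1 1%g) //= big1 => [|x /andP[Gx nt_x]].
  by rewrite mxtrace_regular // eqxx char1 expr1n invr1 mul1r addr0 mulVf ?natrG_neq0.
by rewrite mxtrace_regular // (negPf nt_x) mulr0.
Qed.

Lemma weight_mult_submod n (r : mx_representation F G n) (U : 'M_n)
    (Umod : mxmodule r U) i :
  weight_mult (submod_repr Umod) i = \rank (U *m weight_proj r i).
Proof.
rewrite /weight_mult -(mxrankMfree _ (row_base_free U)).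
have -> : weight_proj (submod_repr Umod) i *m row_base U = row_base U *m weight_proj r i.
  rewrite -!scalemxAl -!scalemxAr; congr (_ *: _).
  rewrite mulmx_suml mulmx_sumr; apply: eq_bigr => x Gx.
  rewrite -scalemxAl -scalemxAr; congr (_ *: _).
  transitivity (val_submod (1%:M *m submod_mx Umod x)); first by rewrite mul1mx.
  by rewrite val_submodJ // /val_submod /= mul1mx.
by rewrite (eqmxMr _ (eq_row_base U)).
Qed.

End FaithfulCharacter.

Lemma segment_crossing (F : fieldType) (a b a' b' : F) :
  b - a + (a' - b') != 0 ->
  let t := (b - a) / (b - a + (a' - b')) in
  (1 - t) * a + t * a' = (1 - t) * b + t * b'.
Proof. by move=> nz t; rewrite /t; field. Qed.

Lemma ord2P (l : 'I_2) : l = 0 \/ l = 1.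
Proof. by case: l => [[|[|//]] lt_l]; [left | right]; apply: val_inj. Qed.

(** * Arrows and potentials on the cyclic set Z/k *)

Section CyclicIntervals.

Variable k : nat.
Implicit Types (i j : 'I_k) (S : {set 'I_k}) (P w : 'I_k -> rat).

Lemma iter_ordS_reach i j : exists m, iter m (@ordS k) i = j.
Proof.
have val_iter m : iter m (@ordS k) i = ((i + m) %% k)%N :> nat.
  elim: m => [|m IH]; first by rewrite addn0 modn_small.
  by rewrite iterS /= IH -addn1 modnDml addn1 addnS.
(* Walking up to 0 first, in [k - i] steps, avoids the truncated difference [j - i]. *)
exists (k - i + j)%N; apply: val_inj => /=.
by rewrite val_iter addnA subnKC 1?ltnW // modnDl modn_small.
Qed.

(* [l] is the axis: the eigencoordinate of character chi lowers the weight by one. *)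
Definition cyc_step (l : 'I_2) i := if l == 0 then ord_pred i else ordS i.

Definition arrow_closed (a : 'I_2 -> 'I_k -> bool) (S : {set 'I_k}) :=
  forall l i, i \in S -> a l i -> cyc_step l i \in S.

(** A proper closed set splits into a maximal cyclic run and its remainder, with no arrow between
    them. Both have nonnegative value, so a total of 0 gives the run value 0; but that value is the
    difference of [P] at two distinct points. *)
Lemma semistable_arrows_stable a P :
    injective P ->
    (forall S, arrow_closed a S -> S != set0 -> S != setT ->
       0 <= \sum_(i in S) (P (ordS i) - P i)) ->
  forall S, arrow_closed a S -> S != set0 -> S != setT ->
    0 < \sum_(i in S) (P (ordS i) - P i).
Proof.
move=> injP semi S clS S0 ST; rewrite lt_def semi // andbT.
have /set0Pn[s Ss] := S0.
have /set0Pn[j0] : ~: S != set0 by rewrite -setCT (inj_eq (@setC_inj _)).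
rewrite inE => S'j0.
(* On the walk upwards from [j0], which is outside [S], the first point met in [S] starts a run. *)
have [i Si S'i] : exists2 i, i \in S & ord_pred i \notin S.
  have [m0 Em0] := iter_ordS_reach j0 s.
  case: (@ex_minnP (fun m => iter m (@ordS k) j0 \in S)).
    by exists m0; rewrite Em0.
  case=> [|m] /=; first by rewrite (negPf S'j0).
  move=> Sm minm; exists (ordS (iter m (@ordS k) j0)) => //.
  by rewrite ordSK; apply/negP => /minm; rewrite ltnn.
(* The length [m] of the run is the first time at which the walk from [i] leaves [S]. *)
have [m0 Em0] := iter_ordS_reach i j0.
case: (@ex_minnP (fun m => iter m (@ordS k) i \notin S)).
  by exists m0; rewrite Em0.
move=> m S'm minm.
have Slt t : (t < m)%N -> iter t (@ordS k) i \in S.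
  by move=> lt_tm; apply/negPn/negP => /minm; rewrite leqNgt lt_tm.
have m_gt0 : (0 < m)%N by case: (m) S'm => //=; rewrite Si.
have predE t : ord_pred (iter t.+1 (@ordS k) i) = iter t (@ordS k) i by rewrite iterS ordSK.
have ordSV j t : ordS j = iter t.+1 (@ordS k) i -> j = iter t (@ordS k) i.
  by rewrite iterS => /(can_inj (@ordSK k)).
(* [T] is the cyclic component of [S] starting at [i]; [T] and [S :\: T] are both closed. *)
pose T := [set iter (t : 'I_m) (@ordS k) i | t : 'I_m].
have TP t : (t < m)%N -> iter t (@ordS k) i \in T.
  by move=> lt_tm; apply/imsetP; exists (Ordinal lt_tm).
have sTS : T \subset S by apply/subsetP => _ /imsetP[t _ ->]; apply: Slt.
(* A repetition would make [i] the successor of a point of the run, putting [ord_pred i] in [S]. *)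
have injT : injective (fun t : 'I_m => iter t (@ordS k) i).
  move=> t u; wlog lt_tu : t u / (t < u)%N => [IH|].
    by case: (ltngtP t u) => [/IH //|lt_ut Etu|/val_inj //]; apply/esym/IH.
  move: (lt_tu); rewrite -subn_gt0 => d_gt0.
  rewrite -[in RHS](subnKC (ltnW lt_tu)) iterD.
  have inj_iter : injective (iter t (@ordS k)).
    by elim: (nat_of_ord t) => //= q IHq x y /(can_inj (@ordSK k)) /IHq.
  move=> /inj_iter; rewrite -(prednK d_gt0) => /(congr1 (@ord_pred k)).
  rewrite predE => Ei; case/negP: S'i; rewrite Ei; apply: Slt.
  by rewrite prednK // (leq_trans (leq_subr _ _)) // ltnW.
have clT : arrow_closed a T.
  move=> l _ /imsetP[t _ ->] al; have := clS l _ (Slt t (ltn_ord t)) al.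
  rewrite /cyc_step; case: (l == 0).
    case: (nat_of_ord t) (ltn_ord t) => [|q] lt_q; first by rewrite (negPf S'i).
    by move=> _; rewrite predE; apply: TP; apply: ltnW.
  rewrite -iterS => Sq; apply: TP; rewrite ltn_neqAle ltn_ord andbT.
  by apply: contraNneq S'm => <-.
have clD : arrow_closed a (S :\: T).
  move=> l j /setDP[Sj T'j] al; rewrite inE (clS l) // andbT.
  apply: contra T'j; rewrite /cyc_step; case: (l == 0) => /imsetP[t _ Ej].
    have {}Ej : j = iter t.+1 (@ordS k) i by rewrite iterS -Ej ord_predK.
    rewrite Ej TP // ltn_neqAle ltn_ord andbT.
    by apply: contraNneq S'm => <-; rewrite -Ej.
  case: (nat_of_ord t) (ltn_ord t) Ej => [|q] lt_q Ej.
    by case/negP: S'i; move: Ej => /= <-; rewrite ordSK.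
  by rewrite (ordSV _ _ Ej) TP // ltnW.
have T0 : T != set0 by apply/set0Pn; exists i; apply: (TP 0%N).
have TT : T != setT by apply: contraNneq S'j0 => TT; apply: (subsetP sTS); rewrite TT inE.
have sumT : \sum_(j in T) (P (ordS j) - P j) = P (iter m (@ordS k) i) - P i.
  rewrite big_imset /=; last by move=> x y _ _; apply: injT.
  rewrite -(big_mkord xpredT (fun t => P (iter t.+1 (@ordS k) i) - P (iter t (@ordS k) i))).
  by rewrite telescope_sumr.
(* If the total is 0, so is the value of [T]; injectivity of [P] then identifies the point after the
   run, which is outside [S], with [i]. *)
apply: contraNneq S'm => sumS; suff /injP-> : P (iter m (@ordS k) i) = P i by [].
apply/eqP; rewrite -subr_eq0 -sumT; move/eqP: sumS; rewrite (big_setID T) /=.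
rewrite (setIidPr sTS) => sum0; have [/eqP D0|D0] := boolP (S :\: T == set0).
  by move: sum0; rewrite D0 big_set0 addr0.
have DT : S :\: T != setT.
  by apply: contraNneq S'j0 => DT; have: j0 \in S :\: T by [rewrite DT inE]; case/setDP.
by move: sum0; rewrite paddr_eq0 ?semi // => /andP[].
Qed.

(** * The arrow diagram of a wall *)

Section WallConstellation.

Variables (P : 'I_k -> rat) (p : rat).

(** Each edge of the cycle is governed by [P] at its upper endpoint, the source of the arrow on axis
    0 and the target of the arrow on axis 1. *)
Definition wall_arrow (l : 'I_2) i := if l == 0 then p < P i else P (ordS i) < p.

(** This makes the product of the two eigencoordinates vanish, so that they commute. *)
Lemma wall_arrowN i : ~~ (wall_arrow 1 i && wall_arrow 0 (ordS i)).
Proof. by rewrite /wall_arrow /=; case: ltgtP. Qed.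

Lemma wall_arrow_semistable S :
  arrow_closed wall_arrow S -> 0 <= \sum_(i in S) (P (ordS i) - P i).
Proof.
(* Summation by parts: each term Q j ([j - 1 in S] - [j in S]) is nonnegative. *)
move=> clS; pose Q j := P j - p.
rewrite (eq_bigr (fun i => Q (ordS i) - Q i)); last first.
  by move=> i _; rewrite /Q opprB addrA subrK.
rewrite sumrB (reindex_inj (can_inj (@ord_predK k))) /=.
rewrite big_mkcond [X in _ - X]big_mkcond -sumrB; apply: sumr_ge0 => j _.
(* The coefficient is nonzero only if [S] separates [j - 1] from [j]; closure under the arrow on
   that edge then fixes the sign of [P j - p]. *)
rewrite ord_predK; have [Sj|S'j] := boolP (j \in S).
  case: ifP => [|/negbT S'pj]; first by rewrite subrr.
  rewrite sub0r oppr_ge0 subr_le0 leNgt.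
  by apply: contra S'pj => lt_p; apply: (clS 0).
case: ifP => [Spj|]; last by rewrite subr0.
rewrite subr0 subr_ge0 leNgt; apply: contra S'j => lt_p.
by rewrite -[j]ord_predK; apply: (clS 1); rewrite // /wall_arrow /= ord_predK.
Qed.

(** The only edges leaving the interval are those below [j1] and below [j2], and both are killed
    because [P] equals [p] there. *)
Lemma wall_arrow_interval (j1 j2 : 'I_k) : P j1 = p -> P j2 = p ->
  arrow_closed wall_arrow [set i : 'I_k | (j1 <= i < j2)%N].
Proof.
move=> P1 P2 l i; rewrite !inE /wall_arrow /cyc_step => /andP[le1 lt2].
case: (l == 0) => lt_p.
  have lt1 : (j1 < i)%N.
    rewrite ltn_neqAle le1 andbT; apply: contraTneq lt_p => /val_inj <-.
    by rewrite P1 ltxx.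
  have -> : ord_pred i = i.-1 :> nat.
    rewrite /=; case: (nat_of_ord i) (ltn_ord i) lt1 => // q lt_q _ /=.
    by rewrite modnDr modn_small // ltnW.
  have i_gt0 : (0 < i)%N by apply: leq_ltn_trans lt1.
  by apply/andP; split; [rewrite -ltnS prednK | rewrite prednK // ltnW].
have vS : ordS i = i.+1 :> nat by rewrite /= modn_small // (leq_ltn_trans lt2).
rewrite vS (leq_trans le1) //= ltn_neqAle lt2 andbT.
apply: contraTneq lt_p => Ei; have -> : ordS i = j2 by apply: val_inj; exact: etrans vS Ei.
by rewrite P2 ltxx.
Qed.

End WallConstellation.

(** * Potentials as partial sums *)

Definition partial_sum w j := \sum_(i : 'I_k | (i < j)%N) w i.

(** The vanishing total matters only at [i = k - 1], whose successor is 0, where the partial sum is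
    empty. *)
Lemma partial_sum_ordS w i :
  \sum_i w i = 0 -> partial_sum w (ordS i) - partial_sum w i = w i.
Proof.
move=> sum0; have split_i : partial_sum w i + w i = \sum_(j : 'I_k | (j <= i)%N) w j.
  rewrite [RHS](bigD1 i) //= addrC; congr (_ + _).
  by apply: eq_bigl => j; rewrite ltn_neqAle andbC.
apply/eqP; rewrite subr_eq addrC split_i /partial_sum; apply/eqP.
have := ltn_ord i; rewrite leq_eqVlt => /orP[/eqP Ek|lt_k].
  have -> : ordS i = 0%N :> nat by rewrite /= Ek modnn.
  rewrite big_pred0 // -[LHS]sum0; apply: eq_bigl => j.
  by rewrite -ltnS Ek ltn_ord.
by apply: eq_bigl => j /=; rewrite modn_small.
Qed.

Lemma partial_sum_interval w (j1 j2 : 'I_k) : (j1 <= j2)%N ->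
  \sum_(i : 'I_k | (j1 <= i < j2)%N) w i = partial_sum w j2 - partial_sum w j1.
Proof.
move=> le12; apply/eqP; rewrite eq_sym subr_eq /partial_sum.
rewrite (bigID (fun i : 'I_k => (j1 <= i)%N)) /=; apply/eqP; congr (_ + _).
  by apply: eq_bigl => i; rewrite andbC.
apply: eq_bigl => i; rewrite -ltnNge andb_idl // => lt1.
exact: leq_trans lt1 le12.
Qed.

(** Increments determine a function up to a constant, since [ordS] reaches every point. *)
Lemma partial_sum_increments (f : 'I_k -> rat) i j :
  partial_sum (fun i => f (ordS i) - f i) i - partial_sum (fun i => f (ordS i) - f i) j
  = f i - f j.
Proof.
set w := fun i => _; have sumw : \sum_i w i = 0.
  rewrite sumrB (reindex_inj (can_inj (@ord_predK k))) /=.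
  by under eq_bigr do rewrite ord_predK; rewrite subrr.
have stepE q : partial_sum w (ordS q) - f (ordS q) = partial_sum w q - f q.
  rewrite -[partial_sum w (ordS q)](subrK (partial_sum w q)) partial_sum_ordS //.
  by rewrite addrC !addrA addNr add0r addrC.
have [m Em] := iter_ordS_reach i j.
have eqD : partial_sum w j - f j = partial_sum w i - f i.
  by rewrite -Em; elim: (m) => //= q <-; rewrite stepE.
by rewrite -[partial_sum w j](subrK (f j)) eqD opprD opprB addrA addrCA subrr addr0.
Qed.

(** The witness [s i] counts the points whose value is below [f i]. *)
Lemma rank_permutation (f : 'I_k -> rat) : injective f ->
  exists s : 'S_k, forall i j, (f i < f j) = (s i < s j)%N.
Proof.
move=> injf; pose A i := [set j | f j < f i].
have ltA i : (#|A i| < k)%N.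
  rewrite -[X in (_ < X)%N]card_ord -cardsT; apply: proper_card.
  by apply/properP; split; [apply: subsetT | exists i; rewrite !inE ?ltxx].
have homoA i j : f i < f j -> (#|A i| < #|A j|)%N.
  move=> lt_ij; apply: proper_card; apply/properP; split.
    by apply/subsetP => q; rewrite !inE => /lt_trans; apply.
  by exists i; rewrite !inE ?ltxx.
have monoA i j : (f i < f j) = (#|A i| < #|A j|)%N.
  apply/idP/idP => [/homoA //|]; case: (ltgtP (f i) (f j)) => // [/homoA|/injf->].
    by case: ltngtP.
  by rewrite ltnn.
have injA : injective (fun i => Ordinal (ltA i)).
  move=> i j [eqA]; apply: injf; apply/eqP; rewrite eq_le !leNgt.
  by rewrite !monoA eqA ltnn.
by exists (perm injA) => i j; rewrite !permE monoA.
Qed.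

(** The order recovers each value: [u i] is the number of [j] with [u j < u i]. *)
Lemma perm_order_inj (s t : 'S_k) :
  (forall i j, (s i < s j)%N = (t i < t j)%N) -> s = t.
Proof.
have card_lt (u : 'S_k) i : #|[set j | (u j < u i)%N]| = u i.
  rewrite (_ : [set j | _] = u @^-1: [set q : 'I_k | (q < u i)%N]); last first.
    by apply/setP => j; rewrite !inE.
  rewrite card_preimset; last exact: perm_inj.
  rewrite -sum1dep_card -(big_ord_widen k (fun=> 1%N) (ltnW (ltn_ord (u i)))).
  by rewrite sum1_card card_ord.
move=> eqst; apply/permP => i; apply: val_inj; rewrite /= -(card_lt s) -(card_lt t).
by apply: eq_card => j; rewrite !inE eqst.
Qed.

End CyclicIntervals.

(** * Constellations as arrow diagrams *)

Section Constellations.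

Variables (R : realType) (gT : finGroupType) (G : {group gT}).
Variables (rho : mx_representation R[i] G 2) (chi : gT -> R[i]) (B : 'M[R[i]]_2).
Hypothesis chiM : {in G &, {morph chi : x y / (x * y)%g >-> x * y}}.
Hypothesis chi_eq1 : {in G, forall x, chi x = 1 <-> x = 1%g}.

Definition axis_char (l : 'I_2) x := if l == 0 then chi x else (chi x)^-1.

Hypothesis unitB : B \in unitmx.
Hypothesis rhoB : forall x, x \in G ->
  rho x *m B = B *m diag_mx (\row_l axis_char l x).

Local Notation step := cyc_step.
Implicit Types (S : {set 'I_#|G|}).

Lemma axis_charV l x : x \in G -> axis_char l x^-1%g = (axis_char l x)^-1.
Proof. by move=> Gx; rewrite /axis_char (charV chiM chi_eq1) //; case: ifP. Qed.

Lemma axis_char_step l (i : 'I_#|G|) x : x \in G ->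
  (axis_char l x)^-1 * chi x ^+ i = chi x ^+ step l i.
Proof.
move=> Gx; have nz := char_neq0 chiM chi_eq1 Gx.
have expS (j : 'I_#|G|) : chi x ^+ ordS j = chi x * chi x ^+ j.
  rewrite -exprS /= expr_mod // (char_expk chiM chi_eq1) //.
rewrite /axis_char /step; case: (l == 0); last by rewrite invrK expS.
by rewrite -{1}(ord_predK i) expS mulKf.
Qed.

(** * Stability conditions as weights *)

Definition theta_weight (theta : rep_function R G) (i : 'I_#|G|) : rat :=
  theta 1%N (char_repr chiM chi_eq1 i).

(** Zero-dimensional representations are all isomorphic, so additivity along the zero submodule says
    that the value equals twice itself. *)
Lemma grothendieck_hom_dim0 theta (r : mx_representation R[i] G 0) :
  grothendieck_hom theta -> theta 0%N r = 0.
Proof.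
case=> thetaI thetaD.
have dim0 n (s : mx_representation R[i] G n) : n = 0%N -> mx_rsim s r.
  move=> n0; exists (0 : 'M_(n, 0)) => //; first by rewrite /row_free mxrank0 n0.
  by move=> x _; rewrite mulmx0 mul0mx.
have U0 : mxmodule r (0 : 'M_0) by apply: mxmodule0.
have := thetaD _ r _ U0; rewrite !(thetaI _ _ _ r); last 2 first.
- by apply: dim0; rewrite mxrank_coker sub0n.
- by apply: dim0; rewrite mxrank0.
by move/eqP; rewrite -subr_eq0 opprD addrA subrr sub0r oppr_eq0 => /eqP.
Qed.

Lemma grothendieck_homE theta n (r : mx_representation R[i] G n) :
  grothendieck_hom theta ->
  theta n r = \sum_i (weight_mult chi r i)%:R * theta_weight theta i.
Proof.
(* Split off the line spanned by a weight vector and induct on the quotient. *)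
move=> homT; elim: {n}_.+1 {-2}n (ltnSn n) r => // m IH [|n] lt_nm r.
  rewrite grothendieck_hom_dim0 // big1 // => i _.
  by rewrite /weight_mult [weight_proj _ _ _]flatmx0 mxrank0 mul0r.
have [i /eqP] : exists i, weight_mult chi r i != 0%N.
  apply/existsP; rewrite -negb_forall; apply/negP => /forallP all0.
  have := sum_weight_mult chiM chi_eq1 r; rewrite big1 // => i _.
  exact/eqP/all0.
move=> /eqP nz_i; have {nz_i} nzE : weight_proj chi r i != 0.
  by rewrite -mxrank_eq0.
set v := nz_row (weight_proj chi r i).
have nzv : v != 0 by rewrite nz_row_eq0.
have vJ x : x \in G -> v *m r x = chi x ^+ i *: v.
  move=> Gx; have /submxP[u ->] : (v <= weight_proj chi r i)%MS by apply: nz_row_sub.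
  by rewrite -mulmxA (weight_projJ chiM chi_eq1) // scalemxAr.
have Umod : mxmodule r <<v>>%MS.
  apply/mxmoduleP => x Gx; rewrite !genmxE (eqmxMr _ (genmxE v)) vJ //.
  exact: scalemx_sub.
have rkU : \rank <<v>>%MS = 1%N by rewrite genmxE rank_rV nzv.
have simU : mx_rsim (char_repr chiM chi_eq1 i) (submod_repr Umod).
  exists (in_submod <<v>>%MS v) => //.
    have sv : val_submod (in_submod <<v>>%MS v) = v by rewrite in_submodK ?genmxE.
    rewrite /row_free -(mxrankMfree _ (row_base_free <<v>>%MS)).
    by rewrite [X in \rank X]sv rank_rV nzv.
  by move=> x Gx; rewrite -in_submodJ ?genmxE // vJ // mul_scalar_mx linearZ.
have [thetaI thetaD] := homT.
rewrite (thetaD _ r _ Umod) -(thetaI _ _ _ _ simU) (IH _ _ (factmod_repr Umod)); last first.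
  by rewrite mxrank_coker rkU subn1.
rewrite -/(theta_weight theta i).
have -> : theta_weight theta i = \sum_j (i == j)%:R * theta_weight theta j.
  rewrite (bigD1 i) //= eqxx mul1r big1 ?addr0 // => j; rewrite eq_sym.
  by move/negPf->; rewrite mul0r.
rewrite -big_split /=; apply: eq_bigr => j _; rewrite -mulrDl -natrD.
rewrite (weight_mult_sub_fact chiM chi_eq1 Umod) -(weight_mult_rsim chiM chi_eq1 _ simU).
by rewrite weight_mult_char.
Qed.

Lemma theta_regular theta : grothendieck_hom theta ->
  theta _ (regular_repr R[i] G) = \sum_i theta_weight theta i.
Proof.
move=> homT; rewrite grothendieck_homE //; apply: eq_bigr => i _.
by rewrite (weight_mult_regular chiM chi_eq1) mul1r.
Qed.

(** Inverse to [theta_weight]: the values on the powers of [chi] can be prescribed at will. *)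
Definition weights_theta (w : 'I_#|G| -> rat) : rep_function R G :=
  fun n r => \sum_i (weight_mult chi r i)%:R * w i.

Lemma weights_theta_hom w : grothendieck_hom (weights_theta w).
Proof.
split=> [n1 n2 r1 r2 sim12|n r U Umod].
  by apply: eq_bigr => i _; rewrite (weight_mult_rsim chiM chi_eq1 _ sim12).
rewrite -big_split /=; apply: eq_bigr => i _.
by rewrite (weight_mult_sub_fact chiM chi_eq1 Umod) natrD mulrDl.
Qed.

Lemma theta_weightK w i : theta_weight (weights_theta w) i = w i.
Proof.
rewrite /theta_weight /weights_theta (bigD1 i) //= weight_mult_char eqxx mul1r.
rewrite big1 ?addr0 // => j; rewrite weight_mult_char eq_sym => /negPf->.
by rewrite mul0r.
Qed.

(** * Subsheaves as closed sets of weights *)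

Section Sheaf.

Variable F : equivariant_sheaf rho.

(** Multiplication by an eigencoordinate, the linear form whose coefficients are column [l] of
    [B]. *)
Definition axis_coord l : 'M[R[i]]_(sheaf_dim F) := \sum_j B j l *: sheaf_coord F j.

Lemma axis_coord_equivariant l x : x \in G ->
  axis_coord l *m sheaf_H0 F x
  = (axis_char l x)^-1 *: (sheaf_H0 F x *m axis_coord l).
Proof.
move=> Gx; rewrite /axis_coord mulmx_suml mulmx_sumr scaler_sumr.
under eq_bigr => j _ do rewrite -scalemxAl sheaf_equivariant // scaler_sumr.
rewrite exchange_big /=; apply: eq_bigr => i _.
under eq_bigr => j _ do rewrite scalerA.
rewrite -scaler_suml -scalemxAr scalerA; congr (_ *: _).
have /matrixP/(_ i l) := rhoB (groupVr Gx); rewrite mul_mx_diag !mxE.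
rewrite axis_charV // mulrC => <-.
by apply: eq_bigr => j _; rewrite mulrC.
Qed.

(** Since [B] is invertible, eigencoordinates and original coordinates are linear combinations of
    each other. *)
Lemma coord_stableP (U : 'M_(sheaf_dim F)) :
  reflect (forall l, stablemx U (axis_coord l)) (coord_stable U).
Proof.
apply: (iffP forallP) => stU l.
  rewrite /axis_coord mulmx_sumr; apply: summx_sub => j _.
  by rewrite -scalemxAr scalemx_sub.
have -> : sheaf_coord F l = \sum_j invmx B j l *: axis_coord j.
  rewrite /axis_coord; under eq_bigr do rewrite scaler_sumr.
  rewrite exchange_big /= (bigD1 l) //= [X in _ + X]big1 => [|i ne_il].
    under eq_bigr => j _ do rewrite scalerA mulrC.
    rewrite -scaler_suml addr0; have /matrixP/(_ l l) := mulmxV unitB.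
    by rewrite !mxE eqxx => ->; rewrite scale1r.
  under eq_bigr => j _ do rewrite scalerA mulrC.
  rewrite -scaler_suml; have /matrixP/(_ i l) := mulmxV unitB.
  by rewrite !mxE (negPf ne_il) => ->; rewrite scale0r.
rewrite mulmx_sumr; apply: summx_sub => j _.
by rewrite -scalemxAr scalemx_sub //; apply: stU.
Qed.

Local Notation E := (weight_proj chi (sheaf_H0 F)).

(** In a constellation this is a map between lines, so its nonvanishing is all that subsheaves
    detect. *)
Definition sheaf_arrow l i := E i *m axis_coord l != 0.

Lemma weight_proj_step l i : E i *m axis_coord l *m E (step l i) = E i *m axis_coord l.
Proof.
rewrite (weight_vector_proj chiM chi_eq1 (i := step l i)) ?eqxx // => x Gx.
rewrite -mulmxA axis_coord_equivariant // -scalemxAr mulmxA.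
by rewrite (weight_projJ chiM chi_eq1 (sheaf_H0 F) i Gx) -scalemxAl scalerA axis_char_step.
Qed.

Lemma weight_proj_orth i j : E i *m E j = if i == j then E i else 0.
Proof.
by apply: (weight_vector_proj chiM chi_eq1) => x Gx; apply: (weight_projJ chiM chi_eq1).
Qed.

Definition weight_support (U : 'M_(sheaf_dim F)) := [set i | U *m E i != 0].

(** A sum of orthogonal idempotents; its row space is the sum of the weight spaces in [S]. *)
Definition weight_span (S : {set 'I_#|G|}) : 'M_(sheaf_dim F) := \sum_(i in S) E i.

Lemma weight_span_proj S i : weight_span S *m E i = if i \in S then E i else 0.
Proof.
rewrite /weight_span mulmx_suml; under eq_bigr do rewrite weight_proj_orth.
case: ifP => Si.
  by rewrite (bigD1 i) //= eqxx big1 ?addr0 // => j /andP[_ /negPf->].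
by rewrite big1 // => j Sj; case: eqP => // Eij; rewrite Eij Si in Sj.
Qed.

Lemma weight_proj_sub_span S i : i \in S -> (E i <= weight_span S)%MS.
Proof.
move=> Si; have := weight_span_proj S i; rewrite Si => <-.
have -> : weight_span S *m E i = E i *m weight_span S; last exact: submxMl.
rewrite weight_span_proj Si /weight_span mulmx_sumr (bigD1 i) //= weight_proj_orth eqxx.
rewrite big1 ?addr0 // => j /andP[_ ne_ji]; rewrite weight_proj_orth eq_sym.
by rewrite (negPf ne_ji).
Qed.

Lemma weight_span_module S : mxmodule (sheaf_H0 F) (weight_span S).
Proof.
apply/mxmoduleP => x Gx; rewrite {1}/weight_span mulmx_suml.
apply: summx_sub => i Si; rewrite (weight_projJ chiM chi_eq1) //.
by rewrite scalemx_sub ?weight_proj_sub_span.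
Qed.

Lemma weight_span_coord_stable S :
  arrow_closed sheaf_arrow S -> coord_stable (weight_span S).
Proof.
move=> clS; apply/coord_stableP => l; rewrite {1}/weight_span mulmx_suml.
apply: summx_sub => i Si; have [->|nzE] := eqVneq (E i *m axis_coord l) 0.
  exact: sub0mx.
rewrite -weight_proj_step (submx_trans (submxMl _ _)) //.
by rewrite weight_proj_sub_span // clS.
Qed.

Hypothesis Fconst : constellation F.

Lemma constellation_dim : sheaf_dim F = #|G|.
Proof. exact: mxrank_rsim Fconst. Qed.

Lemma weight_proj_rank i : \rank (E i) = 1%N.
Proof.
rewrite -/(weight_mult chi (sheaf_H0 F) i) (weight_mult_rsim chiM chi_eq1 _ Fconst).
exact: weight_mult_regular.
Qed.

Lemma weight_spanK S : weight_support (weight_span S) = S.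
Proof.
apply/setP => i; rewrite inE weight_span_proj; case: ifP => _; last by rewrite eqxx.
by rewrite -mxrank_eq0 weight_proj_rank.
Qed.

Lemma weight_support_rank U i : \rank (U *m E i) = (i \in weight_support U).
Proof.
apply/eqP; rewrite inE -mxrank_eq0 eqn_leq.
have := mxrankM_maxr U (E i); rewrite weight_proj_rank.
by case: (\rank _) => [|[]].
Qed.

Lemma submod_theta theta U (Umod : mxmodule (sheaf_H0 F) U) : grothendieck_hom theta ->
  theta _ (submod_repr Umod) = \sum_(i in weight_support U) theta_weight theta i.
Proof.
move=> homT; rewrite grothendieck_homE // [RHS]big_mkcond; apply: eq_bigr => i _.
rewrite (weight_mult_submod chi) weight_support_rank.
by case: (i \in _); rewrite ?mul1r ?mul0r.
Qed.

Lemma rank_submod U : mxmodule (sheaf_H0 F) U -> \rank U = #|weight_support U|.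
Proof.
move=> Umod; rewrite -(sum_weight_mult chiM chi_eq1 (submod_repr Umod)) -[RHS]sum1_card.
rewrite [RHS]big_mkcond; apply: eq_bigr => i _.
by rewrite (weight_mult_submod chi) weight_support_rank; case: (i \in _).
Qed.

(** As [E i] has rank one, it lies in [U] as soon as weight [i] occurs there; a nonzero arrow then
    produces a nonzero vector of [U] in weight [step l i]. *)
Lemma weight_support_closed U : mxmodule (sheaf_H0 F) U -> coord_stable U ->
  arrow_closed sheaf_arrow (weight_support U).
Proof.
move=> Umod /coord_stableP stU l i Ui nzEY.
have subU j : (U *m E j <= U)%MS.
  rewrite -scalemxAr scalemx_sub // mulmx_sumr; apply: summx_sub => x Gx.
  by rewrite -scalemxAr scalemx_sub //; apply: (mxmoduleP Umod).
have sEU : (E i <= U)%MS.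
  apply: submx_trans (subU i); rewrite -(geq_leqif (mxrank_leqif_sup (submxMl U (E i)))).
  by rewrite weight_proj_rank weight_support_rank Ui.
rewrite inE; apply: contraNneq nzEY => UE0.
rewrite -weight_proj_step -submx0 -UE0; apply: submxMr.
by apply: submx_trans (stU l); apply: submxMr.
Qed.

(** A subsheaf has the value of its support, and a closed set is the support of its span. The
    predicate [Q] serves stability and semistability at once. *)
Lemma constellation_subsheavesP (Q : rat -> Prop) theta : grothendieck_hom theta ->
  (forall (U : 'M_(sheaf_dim F)) (Umod : mxmodule (sheaf_H0 F) U),
     coord_stable U -> U != 0 -> ~~ row_full U -> Q (theta _ (submod_repr Umod)))
  <-> (forall S, arrow_closed sheaf_arrow S -> S != set0 -> S != setT ->
         Q (\sum_(i in S) theta_weight theta i)).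
Proof.
move=> homT; split=> [QU S clS S0 ST|QS U Umod stU nzU nfU].
  have := QU (weight_span S) (weight_span_module S); rewrite submod_theta // weight_spanK.
  apply; first exact: weight_span_coord_stable.
    by rewrite -mxrank_eq0 rank_submod ?weight_span_module // weight_spanK cards_eq0.
  rewrite /row_full rank_submod ?weight_span_module // weight_spanK constellation_dim.
  by apply: contra ST => /eqP cS; rewrite eqEcard subsetT cardsT card_ord cS leqnn.
rewrite submod_theta //; apply: QS; first exact: weight_support_closed.
  by rewrite -cards_eq0 -rank_submod // mxrank_eq0.
apply: contra nfU => /eqP UT.
by rewrite /row_full rank_submod // UT cardsT card_ord constellation_dim.
Qed.

End Sheaf.

(** * Constellations with prescribed arrows *)

Section ArrowSheaf.

Variable a : 'I_2 -> 'I_#|G| -> bool.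
Hypothesis aN : forall i, ~~ (a 1 i && a 0 (ordS i)).

Lemma weight_diag_mx_repr :
  mx_repr G (fun x => diag_mx (\row_(i < #|G|) chi x ^+ i)).
Proof.
split=> [|x y Gx Gy].
  rewrite -diag_const_mx; congr diag_mx; apply/rowP => i.
  by rewrite !mxE (char1 chi_eq1) expr1n.
rewrite mulmx_diag; congr diag_mx; apply/rowP => i.
by rewrite !mxE chiM // exprMn.
Qed.
Definition weight_diag_repr := MxRepresentation weight_diag_mx_repr.

Lemma weight_proj_diag i : weight_proj chi weight_diag_repr i = delta_mx i i.
Proof.
apply/matrixP => p q; rewrite /weight_proj !mxE summxE.
under eq_bigr => x Gx do rewrite !mxE.
have [<-|ne_pq] := eqVneq p q; last first.
  rewrite big1 ?mulr0; last by move=> x _; rewrite mulr0n mulr0.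
  by have [pi|] := eqVneq p i; rewrite //= -pi eq_sym (negPf ne_pq).
under eq_bigr => x Gx do rewrite mulr1n mulrC.
rewrite (char_orthogonality chiM chi_eq1) andbb.
by case: eqP; rewrite ?mulr0 // mulVf ?natrG_neq0.
Qed.

(** A nonzero vector from each weight space gives a basis: projecting a linear relation onto weight
    [i] isolates its [i]-th coefficient. *)
Lemma weight_diag_rsim n (r : mx_representation R[i] G n) :
  (forall i, weight_mult chi r i = 1%N) -> mx_rsim weight_diag_repr r.
Proof.
move=> mult1; pose b := \matrix_(i < #|G|) nz_row (weight_proj chi r i).
have bJ i x : x \in G -> nz_row (weight_proj chi r i) *m r x
    = chi x ^+ i *: nz_row (weight_proj chi r i).
  move=> Gx; have /submxP[u ->] := nz_row_sub (weight_proj chi r i).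
  by rewrite -mulmxA (weight_projJ chiM chi_eq1) // scalemxAr.
exists b.
- rewrite -(sum_weight_mult chiM chi_eq1 r) (eq_bigr (fun=> 1%N)) //.
  by rewrite sum1_card card_ord.
- apply: inj_row_free => v vb0; apply/rowP => i; rewrite [RHS]mxE.
  have nzb : nz_row (weight_proj chi r i) != 0.
    by rewrite nz_row_eq0 -mxrank_eq0 -/(weight_mult chi r i) mult1.
  have := congr1 (mulmx^~ (weight_proj chi r i)) vb0.
  rewrite mul0mx (mulmx_sum_row v) mulmx_suml (bigD1 i) //= big1 => [|j ne_ji].
    rewrite addr0 -scalemxAl rowK.
    rewrite (weight_vector_proj chiM chi_eq1 (i := i)) ?eqxx; last by move=> x; apply: bJ.
    by move/eqP; rewrite scaler_eq0 (negPf nzb) orbF => /eqP.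
  rewrite -scalemxAl rowK.
  rewrite (weight_vector_proj chiM chi_eq1 (i := j)); last by move=> x; apply: bJ.
  by rewrite (negPf ne_ji) scaler0.
move=> x Gx; apply/row_matrixP => i.
by rewrite !row_mul row_diag_mx mxE -scalemxAl -rowE rowK bJ.
Qed.

Definition arrow_mx l : 'M[R[i]]_#|G| :=
  \matrix_(i, j) (a l i && (j == step l i))%:R.

(** A composite along different axes goes forth and back over one edge, where [aN] leaves at most
    one direction. *)
Lemma arrow_mxM l l' : l != l' -> arrow_mx l *m arrow_mx l' = 0.
Proof.
move=> ne_l; apply/matrixP => i j; rewrite !mxE big1 // => q _; rewrite !mxE.
have [al|] := boolP (a l i); last by rewrite mul0r.
have [->|] := eqVneq q (step l i); last by rewrite mul0r.
suff -> : a l' (step l i) = false by rewrite mulr0.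
apply/negP; move: ne_l al; have [->|->] := ord2P l; have [->|->] := ord2P l' => // _.
  by move=> a0 a1; have := aN (ord_pred i); rewrite ord_predK a0 a1.
by move=> a1 a0; have := aN i; rewrite a0 a1.
Qed.

Lemma arrow_mxC l l' : arrow_mx l *m arrow_mx l' = arrow_mx l' *m arrow_mx l.
Proof.
by have [->|ne_l] := eqVneq l l'; rewrite // !arrow_mxM // eq_sym.
Qed.

Lemma arrow_mx_diag l x : x \in G ->
  arrow_mx l *m weight_diag_repr x
  = (axis_char l x)^-1 *: (weight_diag_repr x *m arrow_mx l).
Proof.
move=> Gx; apply/matrixP => i j; rewrite mul_mx_diag mul_diag_mx !mxE.
have [->|] := eqVneq j (step l i); last by rewrite andbF mul0r !mulr0.
by rewrite mulrA axis_char_step // mulrC.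
Qed.

(** Passing through [invmx B] makes the eigencoordinates act by [arrow_mx]. *)
Definition arrow_coord j := \sum_l invmx B l j *: arrow_mx l.

Lemma arrow_coordC i j : arrow_coord i *m arrow_coord j = arrow_coord j *m arrow_coord i.
Proof.
rewrite /arrow_coord mulmx_suml [RHS]mulmx_sumr; apply: eq_bigr => l _.
rewrite mulmx_sumr mulmx_suml; apply: eq_bigr => l' _.
by rewrite -!scalemxAl -!scalemxAr !scalerA mulrC arrow_mxC.
Qed.

Lemma arrow_coord_equivariant x j : x \in G ->
  arrow_coord j *m weight_diag_repr x =
    \sum_i rho x^-1%g i j *: (weight_diag_repr x *m arrow_coord i).
Proof.
move=> Gx.
have invBrho : invmx B *m rho x^-1%g
    = diag_mx (\row_l axis_char l x^-1%g) *m invmx B.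
  apply: (canRL (mulmxK unitB)); rewrite -mulmxA rhoB ?groupV //.
  by rewrite mulmxA mulVmx // mul1mx.
under eq_bigr do rewrite mulmx_sumr scaler_sumr.
rewrite exchange_big mulmx_suml /=; apply: eq_bigr => l _.
rewrite -scalemxAl arrow_mx_diag // scalerA.
under eq_bigr => i _ do rewrite -scalemxAr scalerA mulrC.
rewrite -scaler_suml; congr (_ *: _).
have /matrixP/(_ l j) := invBrho; rewrite mul_diag_mx !mxE axis_charV // mulrC => <-.
by [].
Qed.

Definition arrow_sheaf := @EquivariantSheaf R gT G rho #|G| weight_diag_repr
  arrow_coord arrow_coordC (fun x j => @arrow_coord_equivariant x j).

Lemma arrow_sheaf_constellation : constellation arrow_sheaf.
Proof. by apply: weight_diag_rsim => i; apply: weight_mult_regular. Qed.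

Lemma arrow_sheaf_arrow : sheaf_arrow arrow_sheaf =2 a.
Proof.
move=> l i; rewrite /sheaf_arrow.
have -> : axis_coord arrow_sheaf l = arrow_mx l.
  rewrite /axis_coord /= /arrow_coord; under eq_bigr do rewrite scaler_sumr.
  rewrite exchange_big /= (bigD1 l) //= [X in _ + X]big1 => [|j ne_jl].
    under eq_bigr => j _ do rewrite scalerA mulrC.
    rewrite -scaler_suml addr0; have /matrixP/(_ l l) := mulVmx unitB.
    by rewrite !mxE eqxx => ->; rewrite scale1r.
  under eq_bigr => q _ do rewrite scalerA mulrC.
  rewrite -scaler_suml; have /matrixP/(_ j l) := mulVmx unitB.
  by rewrite !mxE (negPf ne_jl) => ->; rewrite scale0r.
rewrite [weight_proj _ _ _]weight_proj_diag.
have [al|/negPf a'l] := boolP (a l i).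
  apply/eqP => /matrixP/(_ i (step l i)) /eqP; rewrite !mxE (bigD1 i) //=.
  rewrite !mxE !eqxx al mul1r big1 ?addr0 ?oner_eq0 // => j /negPf ne_ji.
  by rewrite !mxE ne_ji andbF mul0r.
apply/negbTE; rewrite negbK; apply/eqP/matrixP => p q; rewrite !mxE big1 // => j _.
rewrite !mxE; have [->|] := eqVneq j i; last by rewrite andbF mul0r.
by rewrite a'l mulr0.
Qed.

End ArrowSheaf.

(** * Potentials, genericity and chambers *)

Definition potential theta := partial_sum (theta_weight theta).

Lemma theta_weight_potential theta i : stability_space theta ->
  theta_weight theta i = potential theta (ordS i) - potential theta i.
Proof.
by case=> homT reg0; rewrite partial_sum_ordS // -theta_regular.
Qed.

Lemma generic_stabilityP theta : stability_space theta ->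
  generic_stability rho theta <-> injective (potential theta).
Proof.
move=> stT; have [homT reg0] := stT.
have sumT S : \sum_(i in S) theta_weight theta i
    = \sum_(i in S) (potential theta (ordS i) - potential theta i).
  by apply: eq_bigr => i _; rewrite -theta_weight_potential.
split=> [[_ gen] j1 j2|injP].
  wlog lt12 : j1 j2 / (j1 < j2)%N => [IH eqpot|eqpot].
    by case: (ltngtP j1 j2) => [/IH|/IH/(_ (esym eqpot))|/val_inj] // ->.
  pose a := wall_arrow (potential theta) (potential theta j1).
  have aN i : ~~ (a 1 i && a 0 (ordS i)) by apply: wall_arrowN.
  have constF := arrow_sheaf_constellation aN.
  have clE S : arrow_closed (sheaf_arrow (arrow_sheaf aN)) S <-> arrow_closed a S.
    by split=> clS l i; have := clS l i; rewrite arrow_sheaf_arrow.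
  have semiF : semistable theta (arrow_sheaf aN).
    apply/(constellation_subsheavesP constF (fun x => 0 <= x) homT) => S /clE clS _ _.
    by rewrite sumT; apply: wall_arrow_semistable clS.
  (* This set contains [j1], misses [j2], and has value [potential theta j2 - potential theta j1 =
     0]. *)
  pose I := [set i : 'I_#|G| | (j1 <= i < j2)%N].
  have : 0 < \sum_(i in I) theta_weight theta i.
    have stF := gen _ constF semiF.
    apply: ((constellation_subsheavesP constF (fun x => 0 < x) homT).1 stF).
    - by apply/clE; apply: wall_arrow_interval.
    - by apply/set0Pn; exists j1; rewrite inE leqnn.
    - by apply/negP => /eqP/setP/(_ j2); rewrite !inE ltnn andbF.
  have := partial_sum_interval (theta_weight theta) (ltnW lt12).
  rewrite -/(potential theta j2) -/(potential theta j1) eqpot subrr.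
  by rewrite (eq_bigl (fun i => i \in I)) => [->|i]; rewrite ?ltxx ?inE.
split=> // F constF /(constellation_subsheavesP constF (fun x => 0 <= x) homT) semiF.
apply/(constellation_subsheavesP constF (fun x => 0 < x) homT) => S clS S0 ST.
rewrite sumT; apply: (semistable_arrows_stable injP _ clS S0 ST) => T clT T0 TT.
by rewrite -sumT; apply: semiF.
Qed.

Lemma segment_point_stability (theta theta' : rep_function R G) t :
    stability_space theta -> stability_space theta' ->
  stability_space (segment_point theta theta' t).
Proof.
move=> [[thI thD] reg0] [[thI' thD'] reg0']; split; last first.
  by rewrite /segment_point reg0 reg0' !mulr0 addr0.
split=> [n1 n2 r1 r2 sim12|n r U Umod]; rewrite /segment_point.
  by rewrite (thI _ _ _ _ sim12) (thI' _ _ _ _ sim12).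
by rewrite (thD _ _ _ Umod) (thD' _ _ _ Umod) !mulrDr addrACA.
Qed.

Lemma potential_segment theta theta' t i :
  potential (segment_point theta theta' t) i
  = (1 - t) * potential theta i + t * potential theta' i.
Proof. by rewrite /potential /partial_sum !mulr_sumr -big_split. Qed.

(** Potentials vary linearly along the segment. Two of them in opposite orders at its ends must meet
    inside, where genericity fails, while an order shared by both ends persists in between. *)
Lemma chamber_ofP theta theta' : generic_stability rho theta ->
  chamber_of rho theta theta' <->
  generic_stability rho theta' /\
  forall i j, (potential theta i < potential theta j)
              = (potential theta' i < potential theta' j).
Proof.
move=> genT; have [stT _] := genT; have injT := (generic_stabilityP stT).1 genT.
split=> [[genT' seg]|[genT' same]].
  split=> //; have [stT' _] := genT'.
  have injT' := (generic_stabilityP stT').1 genT'.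
  have homo i j : potential theta i < potential theta j ->
      potential theta' i < potential theta' j.
    move=> ltT; have ne_ij : i != j by apply: contraTneq ltT => ->; rewrite ltxx.
    rewrite ltNge le_eqVlt (inj_eq injT') eq_sym (negPf ne_ij) /=; apply/negP => gtT'.
    pose d := potential theta j - potential theta i.
    pose d' := potential theta' i - potential theta' j.
    have d_gt0 : 0 < d by rewrite subr_gt0.
    have d'_gt0 : 0 < d' by rewrite subr_gt0.
    have dd_gt0 : 0 < d + d' by rewrite addr_gt0.
    (* The point of the segment at which the potentials of i and j coincide. *)
    have genS : generic_stability rho (segment_point theta theta' (d / (d + d'))).
      apply: seg; rewrite divr_ge0 ?(ltW d_gt0) ?(ltW dd_gt0) //=.
      by rewrite ler_pdivrMr // mul1r lerDl ltW.
    have injS := (generic_stabilityP genS.1).1 genS.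
    apply: (negP ne_ij); apply/eqP/injS; rewrite !potential_segment.
    have : d + d' != 0 by rewrite gt_eqF.
    exact: segment_crossing.
  move=> i j; apply/idP/idP => [/homo //|ltT'].
  have ne_ij : i != j by apply: contraTneq ltT' => ->; rewrite ltxx.
  rewrite ltNge le_eqVlt (inj_eq injT) eq_sym (negPf ne_ij) /=; apply/negP => /homo.
  by apply/negP; rewrite -leNgt ltW.
split=> // t /andP[t0 t1]; have [stT' _] := genT'.
have stS := segment_point_stability t stT stT'; apply/(generic_stabilityP stS).
have injT' := (generic_stabilityP stT').1 genT'.
have homo i j : potential theta i < potential theta j ->
    potential (segment_point theta theta' t) i < potential (segment_point theta theta' t) j.
  move=> ltT; have ltT' : potential theta' i < potential theta' j by rewrite -same.
  (* At [t = 0] only [theta] counts; for [t > 0] strictness comes from [theta']. *)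
  rewrite !potential_segment; have [->|nz_t] := eqVneq t 0.
    by rewrite subr0 !mul1r !mul0r !addr0.
  by rewrite ler_ltD ?ler_wpM2l ?(ltW ltT) ?subr_ge0 // ltr_pM2l // lt_def nz_t.
move=> i j eqS; apply: injT.
by case: (ltgtP (potential theta i) (potential theta j)) => // /homo; rewrite eqS ltxx.
Qed.

(** The potential is [s] up to an additive constant, so every order of the weights is realized. *)
Definition perm_theta (s : 'S_#|G|) :=
  weights_theta (fun i => (s (ordS i))%:R - (s i)%:R).

Lemma perm_theta_stability s : stability_space (perm_theta s).
Proof.
have homT := weights_theta_hom (fun i => (s (ordS i))%:R - (s i)%:R).
split=> //; rewrite theta_regular //; under eq_bigr do rewrite theta_weightK.
rewrite sumrB (reindex_inj (can_inj (@ord_predK _))) /=.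
by under eq_bigr do rewrite ord_predK; rewrite subrr.
Qed.

Lemma potential_perm_theta s i j :
  (potential (perm_theta s) i < potential (perm_theta s) j) = (s i < s j)%N.
Proof.
have potE q : potential (perm_theta s) q
    = partial_sum (fun i => (s (ordS i))%:R - (s i)%:R) q.
  by apply: eq_bigr => r _; rewrite theta_weightK.
have := partial_sum_increments (fun i => (s i)%:R) j i.
by rewrite /= -!potE -subr_gt0 => ->; rewrite subr_gt0 ltr_nat.
Qed.

Lemma perm_theta_generic s : generic_stability rho (perm_theta s).
Proof.
apply/(generic_stabilityP (perm_theta_stability s)) => i j eqpot.
case: (ltngtP (s i) (s j)) => [||/val_inj/perm_inj //].
- by rewrite -potential_perm_theta eqpot ltxx.
by rewrite -potential_perm_theta eqpot ltxx.
Qed.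

End Constellations.

(** * Diagonalization of the group action *)

(** The minimal polynomial divides ['X^m - 1], which is split and, in characteristic 0,
    separable. *)
Lemma finite_order_diagonalizable (C : numClosedFieldType) n m (A : 'M[C]_n.+1) :
  (0 < m)%N -> A ^+ m = 1 -> diagonalizable A.
Proof.
move=> m_gt0 Am; apply/diagonalizableP.
have [s Es] := closed_field_poly_normal ('X^m - 1 : {poly C}).
move: Es; rewrite (eqP (monicXnsubC 1 m_gt0)) scale1r => Es; exists s.
  rewrite -separable_prod_XsubC -Es separable_Xn_sub_1 //.
  by rewrite pnatr_eq0 -lt0n.
rewrite -Es mxminpoly_min // rmorphB rmorphXn rmorph1 /= horner_mx_X Am subrr //.
Qed.

(** Commuting matrices of finite order are diagonalized together, and [chi] is the first diagonal
    entry. Determinant 1 makes the second entry its inverse, so [chi x = 1] forces [rho x = 1]. *)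
Lemma SL2_abelian_diagonalization (R : realType) (gT : finGroupType) (G : {group gT})
    (rho : mx_representation R[i] G 2) :
    mx_faithful rho -> (forall g, g \in G -> \det (rho g) = 1) -> abelian G ->
  exists (chi : gT -> R[i]) (B : 'M[R[i]]_2),
    [/\ {in G &, {morph chi : x y / (x * y)%g >-> x * y}},
        {in G, forall x, chi x = 1 <-> x = 1%g},
        B \in unitmx &
        forall x, x \in G -> rho x *m B = B *m diag_mx (\row_l axis_char chi l x)].
Proof.
move=> faithful_rho detrho abG.
have : codiagonalizable [seq rho x | x <- enum G].
  apply/codiagonalizableP; split=> [_ _ /mapP[x Gx ->] /mapP[y Gy ->]|_ /mapP[x Gx ->]].
    move: Gx Gy; rewrite !mem_enum => Gx Gy; rewrite /comm_mx -!repr_mxM //.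
    by rewrite (centsP abG).
  move: Gx; rewrite mem_enum => Gx.
  apply: (@finite_order_diagonalizable _ 1 #|G|); first exact: cardG_gt0.
  have repr_exp m : rho x ^+ m = rho (x ^+ m)%g.
    elim: m => [|m IH]; first by rewrite repr_mx1.
    by rewrite exprS expgS repr_mxM ?groupX // IH.
  by rewrite repr_exp expg_cardG // repr_mx1.
case=> P unitP /allP diagP; pose M x := P *m rho x *m invmx P.
have M_diag x (i j : 'I_2) : x \in G -> i != j -> M x i j = 0.
  move=> Gx ne_ij; apply/(diagonalizable_forP _ unitP) => //.
  by apply: diagP; apply/mapP; exists x; rewrite ?mem_enum.
have M_M x y (i : 'I_2) : x \in G -> y \in G -> M (x * y)%g i i = M x i i * M y i i.
  move=> Gx Gy; have -> : M (x * y)%g = M x *m M y.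
    by rewrite /M !mulmxA mulmxKV // repr_mxM // !mulmxA.
  rewrite mxE (bigD1 i) //= big1 ?addr0 // => j ne_ji.
  by rewrite (M_diag y) // mulr0.
have M_det x : x \in G -> M x 0 0 * M x 1 1 = 1.
  move=> Gx; have detM : \det (M x) = 1.
    by rewrite !det_mulmx detrho // mulr1 -det_mulmx mulmxV // det1.
  have ME : M x = diag_mx (\row_l M x l l).
    apply/matrixP => i j; rewrite [RHS]mxE [X in X *+ _]mxE.
    have [->|ne_ij] := eqVneq i j; first by rewrite mulr1n.
    by rewrite mulr0n; apply: M_diag.
  rewrite ME det_diag !big_ord_recl big_ord0 mulr1 in detM; move: detM.
  by rewrite [X in X * _]mxE [X in _ * X]mxE (_ : lift ord0 ord0 = 1) //; apply: val_inj.
(* Since [P *m rho x *m invmx P] is diagonal, the eigenvectors are the columns of [invmx P]. *)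
exists (fun x => M x 0 0), (invmx P); split.
- by move=> x y Gx Gy; apply: M_M.
- move=> x Gx; split=> [M00|->]; last by rewrite /M repr_mx1 mulmx1 mulmxV // mxE.
  apply/set1gP; apply: (subsetP faithful_rho); apply/rkerP; split=> //.
  have M1 : M x = 1%:M.
    apply/matrixP => i j; rewrite [RHS]mxE; have [->|ne_ij] := eqVneq i j; last first.
      exact: M_diag.
    have [-> //|->] := ord2P j.
    by have := M_det x Gx; rewrite M00 mul1r.
  have -> : rho x = invmx P *m M x *m P by rewrite /M !mulmxA mulmxKV // mulVmx // mul1mx.
  by rewrite M1 mulmx1 mulVmx.
- by rewrite unitmx_inv.
move=> x Gx; have -> : rho x *m invmx P = invmx P *m M x.
  by rewrite /M !mulmxA mulVmx // mul1mx.
congr (_ *m _); apply/matrixP => i j; rewrite [RHS]mxE [X in X *+ _]mxE.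
have [->|ne_ij] := eqVneq i j; last by rewrite mulr0n; apply: M_diag.
rewrite mulr1n /axis_char; have [->//|->] := ord2P j.
have nz : M x 0 0 != 0.
  by apply: contra_eq_neq (M_det x Gx) => ->; rewrite mul0r eq_sym oner_eq0.
by apply: (mulfI nz); rewrite M_det //= divff.
Qed.

(** * Chambers *)

(* Imported only here: classical_sets shadows the set0, setT and subset of finset. *)
From mathcomp Require Import boolp classical_sets cardinality.
Local Open Scope classical_set_scope.
Local Open Scope ring_scope.

Section Chambers.
Variables (R : realType) (gT : finGroupType) (G : {group gT}).
Variables (rho : mx_representation R[i] G 2) (chi : gT -> R[i]) (B : 'M[R[i]]_2).
Hypothesis chiM : {in G &, {morph chi : x y / (x * y)%g >-> x * y}}.
Hypothesis chi_eq1 : {in G, forall x, chi x = 1 <-> x = 1%g}.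
Hypothesis unitB : B \in unitmx.
Hypothesis rhoB : forall x, x \in G ->
  rho x *m B = B *m diag_mx (\row_l axis_char chi l x).

Let chamber_ofE := chamber_ofP chiM chi_eq1 unitB rhoB.

Lemma chamber_of_refl theta :
  generic_stability rho theta -> chamber_of rho theta theta.
Proof. by move=> gen; apply/chamber_ofE. Qed.

(** By [chamber_ofE], sharing a chamber means ordering the weights alike; transitivity, not evident
    from segments, is then immediate. *)
Lemma chamber_of_eq theta theta' : generic_stability rho theta ->
  chamber_of rho theta theta' -> chamber_of rho theta' = chamber_of rho theta.
Proof.
move=> gen /(chamber_ofE _ gen)[gen' same]; apply/seteqP; split=> eta.
  move=> /(chamber_ofE _ gen')[gen2 same2]; apply/(chamber_ofE _ gen); split=> // i j.
  by rewrite same same2.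
move=> /(chamber_ofE _ gen)[gen2 same2]; apply/(chamber_ofE _ gen'); split=> // i j.
by rewrite -same same2.
Qed.

Lemma chambers_partition :
  classical_sets.partition (chambers rho) id (generic_stability rho).
Proof.
split.
- apply/seteqP; split=> [theta [_ [theta0 gen0 <-]] [//]|theta gen].
  by exists (chamber_of rho theta); [exists theta | apply: chamber_of_refl].
- move=> _ _ [theta gen <-] [theta' gen' <-] [eta [/= in1 in2]].
  by rewrite -(chamber_of_eq gen in1) -(chamber_of_eq gen' in2).
by move=> _ [theta gen <-]; exists theta; apply: chamber_of_refl.
Qed.

(** A generic potential is injective, hence orders the weights as some permutation [s] does, and
    shares the chamber of [perm_theta chi s]. *)
Lemma chambersE :
  chambers rho = (fun s => chamber_of rho (perm_theta chi s)) @` [set: 'S_#|G|].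
Proof.
have gen_s s := perm_theta_generic chiM chi_eq1 unitB rhoB s.
apply/seteqP; split=> [_ [theta gen <-]|_ [s _ <-]]; last by exists (perm_theta chi s).
have injP := (generic_stabilityP chiM chi_eq1 unitB rhoB gen.1).1 gen.
have [s Es] := rank_permutation injP; exists s => //.
apply: esym; apply: chamber_of_eq => //; apply/chamber_ofE => //; split=> // i j.
by rewrite potential_perm_theta Es.
Qed.

(** A chamber determines the order of the potentials, and that order determines the permutation. *)
Lemma card_chambers : (chambers rho #= `I_(#|G| `!)%N)%card.
Proof.
have gen_s s := perm_theta_generic chiM chi_eq1 unitB rhoB s.
have injf : injective (fun s => chamber_of rho (perm_theta chi s)).
  move=> s t eq_st; apply: perm_order_inj => i j.
  have : chamber_of rho (perm_theta chi s) (perm_theta chi t).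
    by rewrite eq_st; apply: chamber_of_refl.
  move=> /(chamber_ofE _ (gen_s s))[_ /(_ i j)].
  by rewrite !(potential_perm_theta chiM chi_eq1).
rewrite chambersE (card_eql (inj_card_eq (in2W injf))).
rewrite -card_Sn (card_eqr card_II).
suff <- : (@enum_rank _) @` [set: 'S_#|G|] = setT.
  by rewrite card_eq_sym; apply: inj_card_eq; apply: in2W; apply: enum_rank_inj.
by apply/seteqP; split=> // i _; exists (enum_val i); rewrite ?enum_valK.
Qed.
End Chambers.

Theorem theorem5p17 (R : realType) (gT : finGroupType) (G : {group gT})
    (rho : mx_representation R[i] G 2)
    (rho_faithful : mx_faithful rho)
    (rho_SL : forall g, g \in G -> \det (rho g) = 1)
    (G_abelian : abelian G) :
  classical_sets.partition (chambers rho) id (generic_stability rho) /\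
  (chambers rho #= `I_(#|G| `!)%N)%card.
Proof.
have [chi [B [chiM chi_eq1 unitB rhoB]]] :=
  SL2_abelian_diagonalization rho_faithful rho_SL G_abelian.
split; first exact: chambers_partition chiM chi_eq1 unitB rhoB.
exact: card_chambers chiM chi_eq1 unitB rhoB.
Qed.
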